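(* Let $s\ge2$, $\mu\ge 2$, $n=s\mu-1$ and $\omega\in\Omega_s$. Then the moment system $$\sum_{k=1}^m Z_k z_k^l=\sigma_{1-n+l},\qquad l=0,1,\dots,2n-2,$$ with $\sigma_0=\omega$, $\sigma_\mu=\sigma_{-\mu}=1$, $\sigma_k=0$ for $k\neq0,\pm\mu$, has an admissible solution with $m=n-(\mu-1)$. The distinct numbers $z_k$, $k=1,\dots,m$, are the zeros of the polynomial $z\mapsto\mathcal R_{s-1}(\omega;z^\mu)$, and for $\omega=-2\cos\varphi_\alpha=2\cos\varphi_{s-\alpha+1}$, where $\varphi_\alpha=\frac{\pi\alpha}{s+1}$, $\alpha\in\{1,\dots,s\}$, they form the set $$\{z_k\}=\{z\in\mathbb C:\ z^{(s+1)\mu}=(-1)^\alpha\}\setminus\{z\in\mathbb C:\ z^\mu=e^{i\varphi_\alpha}\ \text{or}\ z^\mu=e^{-i\varphi_\alpha}\}.$$ Moreover $$Z_k=-\frac{\sum_{j\ne k}z_j}{\prod_{j\neq k}(z_k-z_j)}=\frac{z_k}{\prod_{j\ne k}(z_k-z_j)},\qquad k=1,\dots,m.$$ The admissible solution has the form $X_k=Z_kz_k^{n-1}$, $e^{-i\lambda_k}=z_k$, $k=1,\dots,m$, with $X_k,\lambda_k$ real, and the corresponding amplitude and phase operator has order $m=n-(\mu-1)$ and extracts the $\mu$-th harmonic on polynomials of order $n-1$: for every real trigonometric polynomial $T_{n-1}(x)=\sum_{k=1}^{n-1}\tau_k(x)$ with $\tau_k(x)=a_k\cos kx+b_k\sin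 kx$, $a_k,b_k\in\mathbb R$, $$\tau_\mu(x)=\sum_{k=1}^m X_k\,T_{n-1}(x-\lambda_k).$$
   Context: The polynomials $r_k(\omega)$ are defined by $r_{-1}=0$, $r_0=1$, $r_k(\omega)+\omega r_{k-1}(\omega)+r_{k-2}(\omega)=0$ for $k\ge1$. For $s\ge1$, $$\mathcal R_{s-1}(\omega;t)=r_0(\omega)+r_1(\omega)t+\dots+r_{s-1}(\omega)t^{s-1},\qquad \Omega_s=\left\{2\cos\frac{\pi\alpha}{s+1}:\ \alpha=1,\dots,s\right\}.$$ An admissible solution of the moment system is one with all $Z_k$ nonzero, all $z_k=e^{-i\lambda_k}$ pairwise distinct with $\lambda_k$ real (so $|z_k|=1$), and all amplitudes $X_k=Z_kz_k^{n-1}$ real and, like the $\lambda_k$, independent of the trigonometric polynomial to which the operator is applied. An amplitude and phase operator is a transformation $T\mapsto\sum_j X_jT(x-\lambda_j)$ with real $X_j,\lambda_j$; its order is the number of its summands, where the $\exp(i\lambda_j)$ are pairwise distinct and the $X_j$ are nonzero. *)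

(* Defs.v *)
From mathcomp Require Import all_boot all_order all_algebra.
From mathcomp Require Import complex.
From mathcomp Require Import all_classical all_reals all_analysis.

Set Implicit Arguments.
Unset Strict Implicit.
Unset Printing Implicit Defensive.

Import Order.TTheory GRing.Theory Num.Theory.
Local Open Scope ring_scope.
Local Open Scope complex_scope.
Local Open Scope classical_set_scope.

(* exp(i x) for real x *)
Definition expi (R : realType) (x : R) : R[i] := cos x +i* sin x.

(* The index is shifted by one because the recurrence starts at r_(-1) = 0:
   r_shift R k stands for r_(k-1). *)
Fixpoint r_shift (R : realType) (k : nat) : {poly R} :=
  match k with
  | 0 => 0
  | 1 => 1
  | (k''.+1 as k').+1 => - ('X * r_shift R k') - r_shift R k''
  end.

Definition r_poly (R : realType) (k : nat) : {poly R} := r_shift R k.+1.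

Lemma r_polyE (R : realType) (omega : R) (k : nat) :
  (r_shift R k.+2).[omega] + omega * (r_shift R k.+1).[omega]
    + (r_shift R k).[omega] = 0.
Proof. by rewrite [r_shift R k.+2]/= !hornerE addrAC subrK addNr. Qed.

(* The polynomial t |-> r_0(omega) + r_1(omega) t + ... + r_d(omega) t^d. *)
Definition Rcal (R : realType) (d : nat) (omega : R) : {poly R} :=
  \poly_(i < d.+1) (r_poly R i).[omega].

(* The polynomial z |-> Rcal d omega (z^mu), with coefficients in R[i]. *)
Definition Rcal_pow (R : realType) (d mu : nat) (omega : R) : {poly R[i]} :=
  map_poly (real_complex R) (Rcal d omega) \Po 'X^mu.

Definition phi (R : realType) (s alpha : nat) : R :=
  pi * alpha%:R / (s + 1)%:R.

Definition Omega (R : realType) (s : nat) : set R :=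
  [set omega | exists2 alpha : nat,
     (1 <= alpha <= s)%N & omega = 2 * cos (phi R s alpha)].

Definition sigma (R : realType) (mu : nat) (omega : R) (k : int) : R :=
  if k == 0 then omega
  else if (k == mu%:Z) || (k == - mu%:Z) then 1
  else 0.

Definition moment_system (R : realType) (n mu : nat) (omega : R)
    (m : nat) (Z z : 'I_m -> R[i]) : Prop :=
  forall l : nat, (l <= 2 * n - 2)%N ->
    \sum_(k < m) Z k * z k ^+ l = (sigma mu omega (1 - n%:Z + l%:Z))%:C.

(* X and lam do not depend on any trigonometric polynomial: they are arguments
   here, fixed before any polynomial to which the operator is applied. *)
Definition admissible_solution (R : realType) (n mu : nat) (omega : R)
    (m : nat) (Z z : 'I_m -> R[i]) (X lam : 'I_m -> R) : Prop :=
  [/\ moment_system n mu omega Z z,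
      (forall k, Z k != 0),
      injective z,
      (forall k, expi (- lam k) = z k)
    & (forall k, (X k)%:C = Z k * z k ^+ (n - 1))].

Definition ap_operator (R : realType) (m : nat) (X lam : 'I_m -> R)
    (T : R -> R) : R -> R :=
  fun x => \sum_(j < m) X j * T (x - lam j).

Definition ap_order (R : realType) (H : (R -> R) -> R -> R) (m : nat) : Prop :=
  exists X lam : 'I_m -> R,
    [/\ H = ap_operator X lam,
        injective (fun j => expi (lam j))
      & forall j, X j != 0].

Definition trig_harmonic (R : realType) (a b : nat -> R) (k : nat) (x : R) : R :=
  a k * cos (k%:R * x) + b k * sin (k%:R * x).

(* Real trigonometric polynomial of order N without constant term. *)
Definition trig_poly (R : realType) (a b : nat -> R) (N : nat) (x : R) : R :=
  \sum_(1 <= k < N.+1) trig_harmonic a b k x.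

(* Main.v *)
Require Import Defs.
From mathcomp Require Import all_boot all_order all_algebra.
From mathcomp Require Import cyclic separable cyclotomic.
From mathcomp Require Import complex.
From mathcomp Require Import all_classical all_reals all_analysis.
From mathcomp Require Import ring lra zify.

Set Implicit Arguments.
Unset Strict Implicit.
Unset Printing Implicit Defensive.

Import Order.TTheory GRing.Theory Num.Theory.
Local Open Scope ring_scope.
Local Open Scope complex_scope.
Local Open Scope classical_set_scope.

(** Write omega = -2 cos phi with phi = phi_alpha, eps = (-1)^alpha,
    N = (s+1) mu and Q(z) = 1 + omega z^mu + z^(2 mu).  The recurrence for the
    r_k telescopes the product (1 + omega t + t^2) Rcal(omega; t), and since
    sin phi * r_k(-2 cos phi) = sin ((k+1) phi), the only surviving term besides
    the constant is -eps t^(s+1).  Substituting t = z^mu and multiplying by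
    -eps gives a monic polynomial P with Q P = z^N - eps ([trinomialM]).

    Hence the zeros of P are simple and are exactly the N-th roots of eps at
    which Q does not vanish; since Q(z) = (z^mu - e^(i phi)) (z^mu - e^(-i phi)),
    this is the description of the nodes ([node_rootP]).  Differentiating
    Q P = z^N - eps at a node gives Q(z) P'(z) z = N eps, so the weights
    Z = z / P'(z) are also Z = eps z^2 Q(z) / N ([weightE]).  In this form a sum
    over the nodes may be extended to all N-th roots of eps, because Q vanishes
    at the added points ([sum_factor_nodes]).  Power sums over these roots
    vanish unless N divides the exponent ([sum_coset_roots]), and in the range
    of the moment system the only exponent divisible by N is N itself; it is met
    once by each of the three terms of Q, which yields sigma_mu, sigma_0 and
    sigma_(-mu) ([node_moments]).

    Finally, with z = e^(-i lambda), one gets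
    X = Z z^(n-1) = (omega + 2 cos (mu lambda)) / N, which is real
    ([weight_real]).  The other formula for Z holds because the nodes have sum 0
    ([sum_node]), P being a polynomial in z^mu.  The moments
    sum_k X_k e^(-i j lambda_k) = sigma_j for 1 <= j <= n-1 say that the operator
    keeps the mu-th harmonic and kills the others ([ap_operator_extracts]). *)

(** * The complex exponential *)

Lemma expiD (R : realType) (x y : R) : expi (x + y) = expi x * expi y.
Proof. by rewrite /expi cosD sinD; simpc; rewrite [sin x * _ + _]addrC. Qed.

Lemma expi0 (R : realType) : expi (0 : R) = 1.
Proof. by rewrite /expi cos0 sin0. Qed.

Lemma expiMn (R : realType) (k : nat) (x : R) : expi (k%:R * x) = expi x ^+ k.
Proof.
elim: k => [|k IHk]; first by rewrite mul0r expi0 expr0.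
by rewrite -natr1 mulrDl mul1r expiD IHk exprSr.
Qed.

Lemma expiN (R : realType) (x : R) : expi (- x) = (expi x)^-1.
Proof.
have E : expi x * expi (- x) = 1 by rewrite -expiD subrr expi0.
have nz : expi x != 0 by apply: contra_eq_neq E => ->; rewrite mul0r eq_sym oner_eq0.
by apply: (mulfI nz); rewrite E mulfV.
Qed.

Lemma expi_addN (R : realType) (x : R) : expi x + expi (- x) = (2 * cos x)%:C.
Proof.
by apply/eqP; rewrite eq_complex /= cosN sinN subrr mulrDl mul1r !eqxx.
Qed.

Lemma expi_surj (R : realType) (w : R[i]) :
  `|w| = 1 -> exists lam : R, expi (- lam) = w.
Proof.
case: w => a b w1.
have h : a ^+ 2 + b ^+ 2 = 1.
  by apply: complexI; rewrite (add_Re2_Im2 (a +i* b)) w1 expr1n.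
have aB : -1 <= a <= 1 by apply/andP; split; nra.
have ca : cos (acos a) = a by rewrite acosK // in_itv.
have b2 : 1 - a ^+ 2 = b ^+ 2 by rewrite -h addrAC subrr add0r.
have sa : sin (acos a) = `|b| by rewrite sin_acos // b2 sqrtr_sqr.
(* a + ib is e^(i t) with t = acos a or t = - acos a, by the sign of b. *)
case: (lerP 0 b) => b0.
  exists (- acos a); rewrite opprK /expi ca sa ger0_norm //.
by exists (acos a); rewrite /expi cosN sinN ca sa ltr0_norm // opprK.
Qed.

Lemma unity_norm (F : numDomainType) (N a : nat) (w : F) :
  (0 < N)%N -> w ^+ N = (-1) ^+ a -> `|w| = 1.
Proof.
move=> N0 wN; apply/eqP; rewrite -(pexpr_eq1 N0) //.
by rewrite -normrX wN normrX normrN1 expr1n.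
Qed.

(** * Chebyshev values and the telescoping identity *)

(** That is, r_k(- 2 cos x) = U_k(cos x), the Chebyshev polynomial of the
    second kind. *)
Lemma horner_r_shift (R : realType) (x : R) (k : nat) :
  sin x * (r_shift R k).[- 2 * cos x] = sin (k%:R * x).
Proof.
suff [] : sin x * (r_shift R k).[- 2 * cos x] = sin (k%:R * x) /\
          sin x * (r_shift R k.+1).[- 2 * cos x] = sin (k.+1%:R * x) by [].
elim: k => [|k [IH0 IH1]]; first split.
- by rewrite /= horner0 mulr0 mul0r sin0.
- by rewrite /= hornerC mulr1 mul1r.
split=> //.
have E := r_polyE (- 2 * cos x) k.
have -> : k.+2%:R * x = k.+1%:R * x + x by rewrite -[k.+2%:R]natr1; ring.
have K : sin (k%:R * x) = sin (k.+1%:R * x) * cos x - cos (k.+1%:R * x) * sin x.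
  by rewrite -sinB; congr sin; rewrite -[k.+1%:R]natr1; ring.
rewrite sinD.
move: E IH0 IH1; rewrite K.
move: (r_shift R k.+2).[_] (r_shift R k.+1).[_] (r_shift R k).[_] => u v w E E0 E1.
have -> : u = - ((-2 * cos x) * v + w).
  by apply/eqP; rewrite -subr_eq0; apply/eqP; rewrite -E; ring.
rewrite mulrN mulrDr E0 mulrCA E1; ring.
Qed.

Lemma phi_bounds (R : realType) (s alpha : nat) :
  (1 <= alpha <= s)%N -> 0 < phi R s alpha < pi.
Proof.
move=> /andP[a1 a2]; have pi0 := pi_gt0 R.
have s0 : (0 : R) < (s + 1)%:R by rewrite ltr0n; lia.
apply/andP; split; first by rewrite divr_gt0 // mulr_gt0 // ltr0n.
by rewrite ltr_pdivrMr // ltr_pM2l // ltr_nat; lia.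
Qed.

Lemma phi_rev (R : realType) (s alpha : nat) : (alpha <= s)%N ->
  phi R s (s - alpha + 1) = pi - phi R s alpha.
Proof.
move=> a2; rewrite /phi natrD natrB // natrD.
have s0 : (s%:R + 1 : R) != 0 by rewrite natr1 pnatr_eq0.
by field.
Qed.

Lemma sin_natpi (R : realType) (k : nat) (x : R) :
  sin (pi * k%:R - x) = - (-1) ^+ k * sin x.
Proof.
rewrite addrC mulr_natr (alternatingn (@sinDpi R)) sinN; ring.
Qed.

Section AtOmega.
Variables (R : realType) (s alpha : nat).
Hypothesis ha : (1 <= alpha <= s)%N.
Let f := phi R s alpha.
Let om := - 2 * cos f.

Let sf : sin f != 0.
Proof. by rewrite gt_eqF // sin_gt0_pi // phi_bounds. Qed.

(** [r_shift R k] stands for r_(k-1): the two lemmas below give r_s = 0 and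
    r_(s-1) = - (-1)^alpha. *)
Lemma horner_r_top : (r_shift R s.+1).[om] = 0.
Proof.
apply: (mulfI sf); rewrite horner_r_shift mulr0.
have -> : s.+1%:R * f = pi * alpha%:R - 0 :> R.
  rewrite /f /phi addn1; have : s.+1%:R != 0 :> R by rewrite pnatr_eq0.
  by move=> h; field.
by rewrite sin_natpi sin0 mulr0.
Qed.

Lemma horner_r_pretop : (r_shift R s).[om] = - (-1) ^+ alpha.
Proof.
apply: (mulfI sf); rewrite horner_r_shift.
have -> : s%:R * f = pi * alpha%:R - f :> R.
  rewrite /f /phi addn1 -[s.+1%:R]natr1.
  have : s.+1%:R != 0 :> R by rewrite pnatr_eq0.
  by rewrite -natr1 => h; field.
by rewrite sin_natpi mulrC.
Qed.

End AtOmega.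

Lemma Rcal_telescope (R : realType) (d : nat) (om : R) :
  (1 + om%:P * 'X + 'X^2) * Rcal d om =
  1 - (r_shift R d.+2).[om] *: 'X^(d.+1) + (r_shift R d.+1).[om] *: 'X^(d.+2).
Proof.
elim: d => [|d IHd].
  have -> : Rcal 0 om = 1.
    by rewrite /Rcal poly_def big_ord1 /r_poly /= hornerE scale1r.
  have -> : (r_shift R 2).[om] = - om by rewrite /= !hornerE subr0.
  rewrite hornerC -!mul_polyC polyCN expr1; ring.
have -> : Rcal d.+1 om = Rcal d om + (r_shift R d.+2).[om] *: 'X^(d.+1).
  by rewrite /Rcal !poly_def big_ord_recr.
rewrite mulrDr IHd.
have E : (r_shift R d.+3).[om] =
    - (om * (r_shift R d.+2).[om] + (r_shift R d.+1).[om]).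
  have := r_polyE om d.+1; rewrite -addrA => /eqP; rewrite addr_eq0 => /eqP ->; ring.
rewrite E -!mul_polyC !exprS rmorphN rmorphD rmorphM /=; ring.
Qed.

(** * Factors of z^N - c^N *)

Lemma closed_prim_root (F : closedFieldType) (n : nat) :
  n%:R != 0 :> F -> exists z : F, n.-primitive_root z.
Proof.
move=> n0; have npos : (0 < n)%N by rewrite lt0n; apply: contraNneq n0 => ->.
have [r rE] := closed_field_poly_normal ('X^n - 1 : {poly F}).
move: rE; rewrite (monicP (monicXnsubC 1 npos)) scale1r => rE.
have ur : uniq r by rewrite -separable_prod_XsubC -rE separable_Xn_sub_1.
have sr : size r = n.
  by apply: succn_inj; rewrite -(size_prod_XsubC r id) -rE size_XnsubC.
have rr : all n.-unity_root r.
  by apply/allP => w wr; rewrite /root_of_unity rE root_prod_XsubC.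
have /hasP[z _ hz] : has n.-primitive_root r by rewrite has_prim_root ?sr.
by exists z.
Qed.

(** A monic factor P of z^N - c^N, where the cofactor Q is given. *)
Section RootsOfUnityCoset.
Variables (F : fieldType) (N : nat) (c zeta : F).
Hypotheses (hz : N.-primitive_root zeta) (c0 : c != 0).

Let N0 : (0 < N)%N. Proof. exact: prim_order_gt0 hz. Qed.

(** The N distinct N-th roots of c^N, as the coset of the N-th roots of unity
    through c. *)
Definition coset_roots : seq F := [seq c * zeta ^+ k | k <- iota 0 N].

Lemma sum_coset_roots (e : nat) :
  \sum_(w <- coset_roots) w ^+ e = if (N %| e)%N then N%:R * c ^+ e else 0.
Proof.
rewrite big_map -{1}[N]subn0 -/(index_iota 0 N) big_mkord.
under eq_bigr do rewrite exprMn -exprM mulnC exprM.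
rewrite -mulr_sumr; case: ifPn => [|]; rewrite (prim_order_dvd hz).
  move=> /eqP ->; under eq_bigr do rewrite expr1n.
  by rewrite sumr_const card_ord mulrC.
(* Geometric sum of ratio zeta^e <> 1. *)
move=> ne1; have: (zeta ^+ e - 1) * \sum_(i < N) (zeta ^+ e) ^+ i = 0.
  by rewrite -subrX1 -exprM mulnC exprM (prim_expr_order hz) expr1n subrr.
by move/eqP; rewrite mulf_eq0 subr_eq0 (negPf ne1) /= => /eqP ->; rewrite mulr0.
Qed.

Lemma coset_rootsP (w : F) : w \in coset_roots -> w ^+ N = c ^+ N.
Proof.
by move=> /mapP[k _ ->]; rewrite exprMn exprAC (prim_expr_order hz) expr1n mulr1.
Qed.

Lemma coset_roots_uniq : uniq coset_roots.
Proof.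
rewrite map_inj_in_uniq ?iota_uniq // => i j.
rewrite !mem_iota add0n /= => iN jN /(mulfI c0) /eqP.
by rewrite (eq_prim_root_expr hz) !modn_small // => /eqP.
Qed.

Lemma coset_roots_prod :
  'X^N - (c ^+ N)%:P = \prod_(w <- coset_roots) ('X - w%:P).
Proof.
have szN : size ('X^N - (c ^+ N)%:P) = N.+1 by rewrite size_XnsubC.
rewrite {1}(@all_roots_prod_XsubC _ ('X^N - (c ^+ N)%:P) coset_roots).
- by rewrite lead_coefDl ?size_polyXn ?lead_coefXn ?scale1r //
     size_polyN ltnS (leq_trans (size_polyC_leq1 _)).
- by rewrite szN size_map size_iota.
- by apply/allP => w wr; rewrite rootE !hornerE (coset_rootsP wr) subrr.
- by rewrite uniq_rootsE coset_roots_uniq.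
Qed.

Variables P Q : {poly F}.
Hypotheses (Pmon : P \is monic) (QP : Q * P = 'X^N - (c ^+ N)%:P).

(** The zeros of P among the N-th roots of c^N, listed without repetition; when
    P divides z^N - c^N they are all the zeros of P. *)
Definition factor_nodes : seq F := [seq w <- coset_roots | root P w].

Lemma factor_nodes_uniq : uniq factor_nodes.
Proof. exact: filter_uniq coset_roots_uniq. Qed.

Lemma factor_nodes_prod : P = \prod_(w <- factor_nodes) ('X - w%:P).
Proof.
have : P %| \prod_(w <- coset_roots) ('X - w%:P).
  by rewrite -coset_roots_prod -QP dvdp_mull.
move=> /dvdp_prod_XsubC[b].
rewrite eqp_monic ?monic_prod_XsubC // => /eqP PE; rewrite PE.
apply/perm_big/uniq_perm; rewrite ?mask_uniq ?coset_roots_uniq ?factor_nodes_uniq //.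
move=> w; rewrite mem_filter PE root_prod_XsubC.
by apply/idP/andP => [h|[]//]; split=> //; exact: mem_mask h.
Qed.

Lemma factor_root_pow (w : F) : root P w -> w ^+ N = c ^+ N.
Proof.
move=> /rootP Pw; have := congr1 (horner^~ w) QP.
by rewrite !hornerE Pw mulr0 => /esym/eqP; rewrite subr_eq0 => /eqP.
Qed.

Lemma mem_factor_nodes (w : F) : (w \in factor_nodes) = root P w.
Proof. by rewrite [in RHS]factor_nodes_prod root_prod_XsubC. Qed.

Lemma factor_deriv (w : F) : root P w ->
  Q.[w] * P^`().[w] * w = N%:R * c ^+ N.
Proof.
move=> Pw; have := congr1 (fun p => p^`().[w]) QP.
rewrite /= derivM derivB derivXn derivC subr0 !hornerE (rootP Pw) mulr0 add0r.
move=> ->.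
by rewrite -(factor_root_pow Pw) hornerMn hornerXn -mulr_natl -mulrA -exprSr prednK.
Qed.

(** A common zero of P and Q would be a double root of z^N - c^N. *)
Lemma factor_rootP (w : F) :
  root P w <-> w ^+ N = c ^+ N /\ Q.[w] != 0.
Proof.
split=> [Pw|[wN Qw]].
  split; first exact: factor_root_pow.
  apply/eqP => Qw; have := factor_deriv Pw; rewrite Qw !mul0r => /esym/eqP.
  by apply/negP; rewrite mulf_neq0 ?expf_neq0 ?(prim_root_natf_neq0 hz).
have := congr1 (horner^~ w) QP.
rewrite !hornerE wN subrr => /eqP.
by rewrite mulf_eq0 (negPf Qw) rootE.
Qed.

(** The N-th roots of c^N that are not zeros of P are zeros of Q and do not
    contribute. *)
Lemma sum_factor_nodes (f : F -> F) :
  \sum_(w <- factor_nodes) Q.[w] * f w = \sum_(w <- coset_roots) Q.[w] * f w.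
Proof.
rewrite big_filter big_mkcond /= big_seq [RHS]big_seq.
apply: eq_bigr => w wr; case: ifPn => // nr.
have [->|Qw] := eqVneq Q.[w] 0; first by rewrite mul0r.
by case/negP: nr; apply/factor_rootP; rewrite (coset_rootsP wr).
Qed.

End RootsOfUnityCoset.

Lemma deriv_prod_XsubC (F : fieldType) (m : nat) (z : 'I_m -> F) (k : 'I_m) :
  (\prod_(j < m) ('X - (z j)%:P))^`().[z k] = \prod_(j < m | j != k) (z k - z j).
Proof.
rewrite (bigD1 k) //= derivM derivXsubC mul1r !hornerE subrr mul0r addr0 horner_prod.
by apply: eq_bigr => j _; rewrite !hornerE.
Qed.

(** * The polynomial of the nodes *)

(** The polynomial Q(z) = 1 + omega z^mu + z^(2 mu). *)
Definition trinomial (R : realType) (mu : nat) (om : R) : {poly R[i]} :=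
  1 + (om%:C)%:P * 'X^mu + 'X^(2 * mu).

Lemma horner_trinomial (R : realType) (mu : nat) (om : R) (w : R[i]) :
  (trinomial mu om).[w] = 1 + om%:C * w ^+ mu + w ^+ (2 * mu).
Proof. by rewrite /trinomial !hornerE. Qed.

Lemma trinomial_factor (R : realType) (mu : nat) (f : R) (w : R[i]) :
  (trinomial mu (- 2 * cos f)).[w] =
  (w ^+ mu - expi f) * (w ^+ mu - expi (- f)).
Proof.
rewrite horner_trinomial mulrBr !mulrBl (mulnC 2%N) exprM.
have E : expi f * expi (- f) = 1 by rewrite -expiD subrr expi0.
rewrite E mulNr rmorphN /= -expi_addN; ring.
Qed.

(** The polynomial z |-> Rcal_(s-1)(omega; z^mu), normalized to be monic when
    omega = -2 cos phi_alpha: its leading coefficient is then - (-1)^alpha. *)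
Definition node_poly (R : realType) (s mu alpha : nat) (om : R) : {poly R[i]} :=
  (- (-1) ^+ alpha) *: Rcal_pow (s - 1) mu om.

Section NodePoly.
Variables (R : realType) (s mu alpha : nat) (om : R).
Hypotheses (ha : (1 <= alpha <= s)%N) (mu0 : (0 < mu)%N).
Hypothesis (hom : om = - 2 * cos (phi R s alpha)).

Let eps : R[i] := (-1) ^+ alpha.
Let s0 : (0 < s)%N. Proof. by lia. Qed.
Let RC := real_complex R.

Let eps2 : eps * eps = 1.
Proof. by rewrite /eps -exprD addnn -mul2n exprM sqrrN !expr1n. Qed.

Lemma node_poly_root (w : R[i]) :
  root (node_poly s mu alpha om) w = root (Rcal_pow (s - 1) mu om) w.
Proof. by rewrite rootZ // oppr_eq0 signr_eq0. Qed.

Lemma trinomialM :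
  trinomial mu om * node_poly s mu alpha om = 'X^((s + 1) * mu) - eps%:P.
Proof.
have := Rcal_telescope (s - 1) om.
have -> : (s - 1).+2 = s.+1 by lia.
have -> : (s - 1).+1 = s by lia.
rewrite {3 4}hom horner_r_top // horner_r_pretop // scale0r subr0.
move/(congr1 (fun p => map_poly RC p \Po 'X^mu)).
rewrite /= !rmorphM !rmorphD rmorph1 /= rmorphM /= map_polyZ.
rewrite !map_polyXn map_polyX map_polyC /=.
rewrite !(comp_polyD, comp_polyM, comp_polyC, comp_polyZ, comp_polyX) !comp_Xn_poly.
rewrite -!exprM -/(Rcal_pow (s - 1) mu om) => E.
rewrite /trinomial /node_poly -scalerAr mul2n -addnn exprD -polyC1 E.
rewrite scalerDr rmorphN rmorphXn rmorphN1 /= -/eps scalerA mulrNN eps2 scale1r.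
by rewrite addn1 mulnC scaleNr alg_polyC addrC.
Qed.

Lemma Rcal_lead : lead_coef (Rcal (s - 1) om) = - (-1) ^+ alpha /\
  size (Rcal (s - 1) om) = s.
Proof.
have E : (r_poly R (s - 1)).[om] = - (-1) ^+ alpha.
  by rewrite /r_poly -[X in r_shift _ X](_ : s = _) ?hom ?horner_r_pretop //; lia.
have n0 : (r_poly R (s - 1)).[om] != 0 by rewrite E oppr_eq0 signr_eq0.
split; first by rewrite lead_coef_poly.
by rewrite size_poly_eq //; lia.
Qed.

Lemma node_poly_monic : node_poly s mu alpha om \is monic.
Proof.
rewrite monicE lead_coefZ lead_coef_comp ?size_polyXn //.
rewrite lead_coefXn expr1n mulr1 lead_coef_map Rcal_lead.1 rmorphN rmorphXn rmorphN1 /=.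
by rewrite mulrNN eps2.
Qed.

Lemma node_poly_size : (size (node_poly s mu alpha om)).-1 = ((s - 1) * mu)%N.
Proof.
rewrite size_scale ?oppr_eq0 ?signr_eq0 // size_comp_poly size_polyXn.
by rewrite size_map_poly Rcal_lead.2 subn1.
Qed.

Lemma node_poly_coef (i : nat) : ~~ (mu %| i)%N ->
  (node_poly s mu alpha om)`_i = 0.
Proof. by move=> /negPf h; rewrite coefZ coef_comp_poly_Xn // h mulr0. Qed.

End NodePoly.

(** * Extraction of a harmonic *)

Lemma sum_complex (R : rcfType) (I : Type) (r : seq I) (f g : I -> R) :
  \sum_(i <- r) (f i +i* g i) = (\sum_(i <- r) f i) +i* (\sum_(i <- r) g i).
Proof.
elim: r => [|i r IH]; first by rewrite !big_nil.
by rewrite !big_cons IH; simpc.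
Qed.

(** If the exponential sums sum_k X_k e^(-i j lambda_k) equal 1 for j = mu and
    0 for the other 1 <= j <= d, the operator extracts the mu-th harmonic from
    polynomials of order d. *)
Lemma ap_operator_extracts (R : realType) (m d mu : nat) (X lam : 'I_m -> R)
    (a b : nat -> R) (x : R) :
  (1 <= mu <= d)%N ->
  (forall j, (1 <= j <= d)%N ->
     \sum_(k < m) (X k)%:C * expi (- lam k) ^+ j = (j == mu)%:R) ->
  trig_harmonic a b mu x = ap_operator X lam (trig_poly a b d) x.
Proof.
move=> hmu H; rewrite /ap_operator /trig_poly.
under eq_bigr do rewrite mulr_sumr.
rewrite exchange_big /=.
transitivity (\sum_(1 <= j < d.+1) (j == mu)%:R * trig_harmonic a b j x).
  rewrite (bigD1_seq mu) ?iota_uniq ?mem_index_iota //= eqxx mul1r big1 ?addr0 //.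
  by move=> j /negPf ->; rewrite mul0r.
apply: eq_big_nat => j hj.
have := H j hj.
rewrite (eq_bigr (fun k => (X k * cos (j%:R * lam k))
                            +i* (- (X k * sin (j%:R * lam k))))); last first.
  by move=> k _; rewrite -expiMn mulrN /expi cosN sinN; simpc.
rewrite sum_complex sumrN.
move=> /eqP; rewrite -(rmorph_nat (real_complex R)) eq_complex /= oppr_eq0.
move=> /andP[/eqP C0 /eqP S0].
transitivity (\sum_(k < m) ((X k * cos (j%:R * lam k)) * trig_harmonic a b j x
   + (X k * sin (j%:R * lam k)) * (a j * sin (j%:R * x) - b j * cos (j%:R * x)))).
  by rewrite big_split /= -!mulr_suml C0 S0 mul0r addr0.
apply: eq_bigr => k _; rewrite /trig_harmonic (mulrBr j%:R) cosB sinB; ring.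
Qed.

(** * Nodes and weights *)

Lemma dvdn_lt_double (N e : nat) :
  (0 < e < 2 * N)%N -> (N %| e)%N = (e == N).
Proof.
move=> /andP[e0 e2]; apply/idP/eqP => [/dvdnP[k ek]|->]; last exact: dvdnn.
have k2 : (k < 2)%N by rewrite -(ltn_pmul2r (_ : 0 < N)%N) -?ek //; lia.
by case: k k2 ek => [|[|k]] // _ ek; lia.
Qed.

(** Throughout, z^N - eps is factored as Q P with N = (s+1) mu, and [zeta] is a
    primitive N-th root of unity. *)
Section Nodes.
Variables (R : realType) (s mu alpha : nat) (om : R).
Hypotheses (hs : (2 <= s)%N) (hmu : (2 <= mu)%N) (ha : (1 <= alpha <= s)%N).
Hypothesis (hom : om = - 2 * cos (phi R s alpha)).

Let mu0 : (0 < mu)%N. Proof. by lia. Qed.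
Let eps : R[i] := (-1) ^+ alpha.
Let N := ((s + 1) * mu)%N.
Let P := node_poly s mu alpha om.
Let Q := trinomial mu om.

Let NE : N = (s * mu + mu)%N. Proof. by rewrite /N mulnDl mul1n. Qed.
Let smu : (2 * mu <= s * mu)%N. Proof. by rewrite leq_mul2r hs orbT. Qed.
Let N0 : (0 < N)%N. Proof. by lia. Qed.

Let c : R[i] := N.-root eps.
Let cN : c ^+ N = eps. Proof. exact: rootCK. Qed.
Let eps0 : eps != 0. Proof. by rewrite signr_eq0. Qed.
Let c0 : c != 0.
Proof. by apply: contraNneq eps0 => c0; rewrite -cN c0 expr0n gtn_eqF. Qed.
Variable zeta : R[i].
Hypothesis hz : N.-primitive_root zeta.

Let r : seq R[i] := factor_nodes N c zeta P.
Let Pmon : P \is monic. Proof. exact: node_poly_monic. Qed.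
Let QP : Q * P = 'X^N - (c ^+ N)%:P.
Proof. by rewrite cN; exact: trinomialM. Qed.
Let rU : uniq r. Proof. exact: factor_nodes_uniq. Qed.
Let rE : P = \prod_(w <- r) ('X - w%:P).
Proof. by rewrite [LHS](factor_nodes_prod hz c0 Pmon QP). Qed.

Lemma node_rootP (w : R[i]) :
  root (Rcal_pow (s - 1) mu om) w <->
  w ^+ ((s + 1) * mu) = (-1) ^+ alpha /\
  ~ (w ^+ mu = expi (phi R s alpha) \/ w ^+ mu = expi (- phi R s alpha)).
Proof.
rewrite -(node_poly_root _ _ alpha) (factor_rootP hz c0 QP) cN.
rewrite /Q hom trinomial_factor mulf_eq0 !subr_eq0 negb_or.
split=> -[-> h]; split=> //.
  by case/andP: h => h1 h2 [] /eqP; apply/negP.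
by apply/andP; split; apply/eqP => hh; apply: h; [left|right].
Qed.

Let m := ((s - 1) * mu)%N.
Let mE : m = (s * mu - mu)%N. Proof. by rewrite /m mulnBl mul1n. Qed.

Let rsize : size r = m.
Proof.
have := @node_poly_size _ s mu alpha om ha mu0 hom.
by rewrite -/P rE size_prod_XsubC.
Qed.

(** The k-th zero of P, for k < m = (s-1) mu = n - (mu-1). *)
Definition node (k : 'I_m) : R[i] := (factor_nodes N c zeta P)`_k.

Lemma node_in (k : 'I_m) : node k \in r.
Proof. by rewrite mem_nth // rsize. Qed.

Lemma node_inj : injective node.
Proof.
by move=> i j /eqP; rewrite nth_uniq ?rsize // => /eqP /val_inj.
Qed.

Lemma big_node (T : nmodType) (f : R[i] -> T) :
  \sum_(k < m) f (node k) = \sum_(w <- r) f w.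
Proof. by rewrite (big_nth 0) rsize big_mkord. Qed.

Lemma range_node : range node = [set w | root (Rcal_pow (s - 1) mu om) w].
Proof.
apply/seteqP; split=> w /=.
  move=> [k _ <-]; rewrite -(node_poly_root _ _ alpha) -(mem_factor_nodes hz c0 Pmon QP).
  exact: node_in.
rewrite -(node_poly_root _ _ alpha) -(mem_factor_nodes hz c0 Pmon QP) => wr.
have h : (index w r < m)%N by rewrite -rsize index_mem.
by exists (Ordinal h) => //=; rewrite /node nth_index.
Qed.

Lemma node_root (k : 'I_m) : root P (node k).
Proof. by rewrite -(mem_factor_nodes hz c0 Pmon QP) node_in. Qed.

Lemma node_pow (k : 'I_m) : node k ^+ N = eps.
Proof. by rewrite (factor_root_pow QP (node_root k)) cN. Qed.

Lemma node_neq0 (k : 'I_m) : node k != 0.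
Proof. by apply: contraNneq eps0 => h; rewrite -(node_pow k) h expr0n gtn_eqF. Qed.

(** The amplitude Z_k = z_k / prod_(j <> k) (z_k - z_j). *)
Definition weight (k : 'I_m) : R[i] :=
  node k / \prod_(j < m | j != k) (node k - node j).

Let den_neq0 (k : 'I_m) : \prod_(j < m | j != k) (node k - node j) != 0.
Proof.
apply/prodf_neq0 => j jk; rewrite subr_eq0.
by apply: contra jk => /eqP /node_inj ->.
Qed.

Lemma weight_neq0 (k : 'I_m) : weight k != 0.
Proof. by rewrite mulf_neq0 ?invr_eq0 ?node_neq0. Qed.

Let NC0 : N%:R != 0 :> R[i]. Proof. exact: prim_root_natf_neq0 hz. Qed.

Lemma weightE (k : 'I_m) :
  weight k = (N%:R * eps)^-1 * (Q.[node k] * node k ^+ 2).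
Proof.
have := factor_deriv hz QP (node_root k).
have -> : P^`().[node k] = \prod_(j < m | j != k) (node k - node j).
  by rewrite -deriv_prod_XsubC rE (big_nth 0) rsize big_mkord.
rewrite cN -/eps /weight => <-.
set D := \prod_(j < m | _) _.
have D0 : D != 0 := den_neq0 k.
have z0 := node_neq0 k.
have Q0 : Q.[node k] != 0.
  by case: (factor_rootP hz c0 QP (node k)) => /(_ (node_root k))[].
by field; rewrite z0 D0 Q0.
Qed.

(** The sum of the zeros is minus the coefficient of z^(m-1) in P, and mu does
    not divide m-1. *)
Lemma sum_node : \sum_(j < m) node j = 0.
Proof.
rewrite (big_node id); apply/eqP; rewrite -oppr_eq0.
have m0 : (0 < m)%N by lia.
rewrite -coefPn_prod_XsubC; last by rewrite rsize -lt0n.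
rewrite -rE node_poly_coef // rsize.
have hm : (mu %| m)%N by rewrite dvdn_mull.
apply/negP => h; have : (mu %| m - m.-1)%N by rewrite dvdn_sub.
rewrite (_ : m - m.-1 = 1)%N ?dvdn1 //; lia.
Qed.

Lemma weight_sumE (k : 'I_m) : weight k =
  - (\sum_(j < m | j != k) node j) / \prod_(j < m | j != k) (node k - node j).
Proof.
have := sum_node; rewrite (bigD1 k) //= => /eqP; rewrite addr_eq0 => /eqP E.
by rewrite /weight {1}E.
Qed.

Lemma node_moments : moment_system (s * mu - 1) mu om weight node.
Proof.
move=> l hl.
under eq_bigr do rewrite weightE -mulrA -mulrA -exprD.
rewrite -mulr_sumr (big_node (fun w => Q.[w] * w ^+ (2 + l))).
rewrite (sum_factor_nodes hz c0 QP (fun w => w ^+ (2 + l))).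
have -> : \sum_(w <- coset_roots N c zeta) Q.[w] * w ^+ (2 + l) =
   \sum_(w <- coset_roots N c zeta) w ^+ (2 + l)
   + om%:C * \sum_(w <- coset_roots N c zeta) w ^+ (mu + (2 + l))
   + \sum_(w <- coset_roots N c zeta) w ^+ (2 * mu + (2 + l)).
  rewrite mulr_sumr -!big_split /=; apply: eq_bigr => w _.
  by rewrite horner_trinomial !mulrDl mul1r -mulrA -!exprD.
(* The exponents lie strictly between 0 and 2N. *)
rewrite !(sum_coset_roots _ hz) !dvdn_lt_double; try by lia.
rewrite /sigma.
have -> : (1 - (s * mu - 1)%N%:Z + l%:Z == 0) = (mu + (2 + l) == N)%N.
  by apply/eqP/eqP; lia.
have -> : (1 - (s * mu - 1)%N%:Z + l%:Z == mu%:Z) = (2 + l == N)%N.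
  by apply/eqP/eqP; lia.
have -> : (1 - (s * mu - 1)%N%:Z + l%:Z == - mu%:Z) =
    (2 * mu + (2 + l) == N)%N.
  by apply/eqP/eqP; lia.
case: eqP => [E1|_]; case: eqP => [E2|_]; case: eqP => [E3|_]; try lia;
  rewrite ?E1 ?E2 ?E3 ?cN ?mulr0 ?addr0 ?add0r ?mulr0 //.
- by rewrite mulVf // mulf_neq0.
- by rewrite mulrCA mulVf ?mulr1 // mulf_neq0.
- by rewrite mulVf // mulf_neq0.
Qed.

Lemma weight_real (k : 'I_m) :
  exists x : R, x%:C = weight k * node k ^+ (s * mu - 1 - 1).
Proof.
have n1 : `|node k| = 1 by apply: (unity_norm N0 (node_pow k)).
have [lam lamE] := expi_surj n1.
(* Z z^(n-1) = z^(s mu) Q(z) / (N eps), where z^((s+1) mu) = eps and n = s mu - 1. *)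
exists ((om + 2 * cos (mu%:R * lam)) / N%:R).
rewrite weightE -!mulrA -!exprS.
rewrite (_ : (s * mu - 1 - 1).+2 = s * mu)%N; last by lia.
rewrite horner_trinomial.
have E : node k ^+ mu * expi (mu%:R * lam) = 1.
  by rewrite -lamE -expiMn -expiD mulrN addNr expi0.
have E2 : (2 * cos (mu%:R * lam))%:C = node k ^+ mu + expi (mu%:R * lam).
  by rewrite -lamE -expiMn mulrN addrC expi_addN.
have E3 : node k ^+ (s * mu) * node k ^+ mu = eps by rewrite -exprD -NE node_pow.
rewrite rmorphM rmorphD /= E2 fmorphV rmorph_nat mul2n -addnn exprD.
have -> : node k ^+ (s * mu) = eps * expi (mu%:R * lam).
  by rewrite -E3 -mulrA E mulr1.
move: E; set u := node k ^+ mu; set v := expi _ => E.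
have -> : (1 + om%:C * u + u * u) * (eps * v) =
    eps * (v + om%:C * (u * v) + u * (u * v)) by ring.
rewrite E; field.
by rewrite NC0 eps0.
Qed.

End Nodes.

Theorem theorem7 (R : realType) (s mu n m : nat) (omega : R)
    (hs : (2 <= s)%N) (hmu : (2 <= mu)%N)
    (hn : n = (s * mu - 1)%N) (hm : m = (n - (mu - 1))%N)
    (homega : Omega s omega) :
  exists (Z z : 'I_m -> R[i]) (X lam : 'I_m -> R),
    admissible_solution n mu omega Z z X lam
    /\ range z = [set w : R[i] | root (Rcal_pow (s - 1) mu omega) w]
    /\ (forall alpha : nat, (1 <= alpha <= s)%N ->
          omega = - 2 * cos (phi R s alpha) ->
          omega = 2 * cos (phi R s (s - alpha + 1))
          /\ range z =
               [set w : R[i] | w ^+ ((s + 1) * mu) = (- 1) ^+ alpha]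
               `\` [set w : R[i] | w ^+ mu = expi (phi R s alpha)
                                   \/ w ^+ mu = expi (- phi R s alpha)])
    /\ (forall k : 'I_m,
          Z k = - (\sum_(j < m | j != k) z j)
                  / \prod_(j < m | j != k) (z k - z j)
          /\ Z k = z k / \prod_(j < m | j != k) (z k - z j))
    /\ ap_order (ap_operator X lam) m
    /\ (forall (a b : nat -> R) (x : R),
          trig_harmonic a b mu x = ap_operator X lam (trig_poly a b (n - 1)) x).
Proof.
have [alpha' ha' oE] := homega.
(* omega = 2 cos phi_alpha' = -2 cos phi_al for the reflected index al. *)
pose al := (s - alpha' + 1)%N.
have hal : (1 <= al <= s)%N by rewrite /al; lia.
have hom : omega = - 2 * cos (phi R s al).
  rewrite /al phi_rev; last by lia.
  by rewrite addrC cosDpi cosN oE mulrN mulNr opprK.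
have mu0 : (0 < mu)%N by lia.
have NC0 : ((s + 1) * mu)%N%:R != 0 :> R[i] by rewrite pnatr_eq0; lia.
have [zeta hz] := closed_prim_root NC0.
have smu : (2 * mu <= s * mu)%N by rewrite leq_mul2r hs orbT.
have mE : m = ((s - 1) * mu)%N by rewrite hm hn mulnBl mul1n; lia.
subst n m; move: mE => ->.
pose z := @node R s mu al omega zeta.
pose Z := @weight R s mu al omega zeta.
have zN k : z k ^+ ((s + 1) * mu) = (-1) ^+ al.
  by exact: (node_pow hs hmu hal hom hz).
have [lam lamE] : {lam : 'I_((s - 1) * mu) -> R & forall k, expi (- lam k) = z k}.
  apply: (@choice _ _ (fun k l => expi (- l) = z k)) => k.
  by apply/expi_surj/(unity_norm _ (zN k)); rewrite lt0n -(pnatr_eq0 R[i]).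
have [X XE] : {X : 'I_((s - 1) * mu) -> R &
    forall k, (X k)%:C = Z k * z k ^+ (s * mu - 1 - 1)}.
  apply: (@choice _ _ (fun k x => x%:C = Z k * z k ^+ (s * mu - 1 - 1))) => k.
  exact: (weight_real hs hmu hal hom hz).
have z_inj : injective z by exact: (node_inj hs hmu hal hom hz).
have Z0 k : Z k != 0 by exact: (weight_neq0 hs hmu hal hom hz).
have mom : moment_system (s * mu - 1) mu omega Z z.
  by exact: (node_moments hs hmu hal hom hz).
have rz : range z = [set w | root (Rcal_pow (s - 1) mu omega) w].
  exact: (range_node hs hmu hal hom hz).
exists Z, z, X, lam; split; [|split; [|split; [|split; [|split]]]] => //.
- move=> alpha ha oa; split.
    by rewrite phi_rev ?oa; [rewrite addrC cosDpi cosN mulrN mulNr|lia].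
  rewrite rz; apply/seteqP; split=> w /=; by move/(node_rootP hs hmu ha oa hz).
- move=> k; split=> //; exact: (weight_sumE hs hmu hal hom hz).
- exists X, lam; split=> // [i j|j].
    move=> E; apply: z_inj; rewrite -!lamE !expiN; congr (_^-1); exact: E.
  have : (X j)%:C != 0.
    rewrite XE mulf_neq0 // expf_neq0 //; exact: (node_neq0 hs hmu hal hom hz).
  by apply: contra => /eqP ->.
- move=> a b x; apply: ap_operator_extracts => [|j hj].
    by lia.
  have hl : (s * mu - 1 - 1 + j <= 2 * (s * mu - 1) - 2)%N by lia.
  have := mom _ hl.
  under eq_bigr do rewrite exprD mulrA -XE -lamE.
  move=> ->.
  rewrite (_ : 1 - _ + _ = j%:Z); last by lia.
  rewrite /sigma.
  rewrite (_ : (j%:Z == 0) = false); last by apply/eqP; lia.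
  rewrite (_ : (j%:Z == - mu%:Z) = false); last by apply/eqP; lia.
  by rewrite orbF (_ : (j%:Z == mu%:Z) = (j == mu)) //; case: eqP.
Qed.
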